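(* Let $h\geq 3$ be a constant, let $G$ be a graph on $n$ vertices, and let $s=\frac{1}{h^h}$. For any $\Lambda$ with $\Lambda=\omega(1)$: (1) for every vertex $v$ with $t_G(v)\geq \Lambda\cdot (2h\log n)^{(h-1)^2}\cdot \frac{2}{s}$, there exists a vector $P\in\mathsf{Product}_h(\Lambda)$ such that $v[P]\geq (1-1/e)^{h-1}\cdot s$; (2) for every vertex $v$ with $t_G(v)\leq \Lambda/\log n$ and every vector $P\in\mathsf{Product}_h(\Lambda)$, we have $v[P]\leq 1/\log n$.
   Context: An $h$-cycle is a cycle on $h$ distinct vertices; $t_G(v)$ is the number of $h$-cycles of $G$ containing $v$. Logarithms are base 2. $\mathsf{Product}_h(\Lambda)$ is the set of vectors $(p_1,\dots,p_h)\in[0,1]^h$ such that each $p_i\in\{2^{-j}: j \text{ an integer}, 0\leq j\leq \log(\Lambda)+1\}$ and $\prod_{i=1}^h p_i\leq 1/\Lambda$. For $P=(p_1,\dots,p_h)\in[0,1]^h$, the $P$-discovery experiment is: sample a uniformly random coloring $\varphi:V(G)\to[h]$ (each vertex independently gets a uniform color), then keep each vertex of color class $i$ independently with probability $p_i$, and let $F$ be the induced subgraph on the kept vertices; $v$ is $P$-discovered if $v$ lies on an $h$-cycle of $F$ whose $h$ vertices have $h$ distinct colors under $\varphi$. $v[P]$ denotes the probability that $v$ is $P$-discovered. *)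

(* Defs.v *)
From HB Require Import structures.
From mathcomp Require Import all_boot all_order all_algebra.
From mathcomp Require Import reals sequences exp.
Set Implicit Arguments. Unset Strict Implicit. Unset Printing Implicit Defensive.
Import Order.TTheory GRing.Theory Num.Theory.
Local Open Scope ring_scope.

(* A simple graph: vertex type V (finite), adjacency relation e, assumed
   symmetric and irreflexive in the theorem. *)

Definition log2 {R : realType} (x : R) : R := ln x / ln 2.

Definition cycle_edges {V : finType} (h : nat) (c : {ffun 'I_h -> V}) : {set {set V}} :=
  [set [set c i; c (ordS i)] | i : 'I_h].

Definition is_hcycle_seq {V : finType} (e : rel V) {h : nat} (c : {ffun 'I_h -> V}) : bool :=
  injectiveb c && [forall i : 'I_h, e (c i) (c (ordS i))].

Definition is_hcycle {V : finType} (e : rel V) (h : nat) (C : {set {set V}}) : bool :=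
  [exists c : {ffun 'I_h -> V}, is_hcycle_seq e c && (C == cycle_edges c)].

Definition tG {V : finType} (e : rel V) (h : nat) (v : V) : nat :=
  #|[set C : {set {set V}} | is_hcycle e h C && [exists E in C, v \in E]]|.

Definition inProduct {R : realType} (h : nat) (Lam : R) (P : 'I_h -> R) : Prop :=
  (forall i : 'I_h, exists j : nat, (j%:R <= log2 Lam + 1) /\ P i = (2%:R ^- j))
  /\ \prod_(i < h) P i <= Lam^-1.

(* v is P-discovered given the coloring phi and the kept vertex set S:
   v lies on an h-cycle of G[S] whose vertices have h distinct colors. *)
Definition discovered {V : finType} (e : rel V) {h : nat}
    (phi : {ffun V -> 'I_h}) (S : {set V}) (v : V) : bool :=
  [exists c : {ffun 'I_h -> V},
     [&& is_hcycle_seq e c, v \in codom c, [forall i, c i \in S]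
       & injectiveb (fun i => phi (c i))]].

(* v[P]: probability that v is P-discovered *)
Definition vP {R : realType} {V : finType} (e : rel V) {h : nat} (P : 'I_h -> R) (v : V) : R :=
  \sum_(phi : {ffun V -> 'I_h}) \sum_(S : {set V})
     ((h%:R ^- #|V|) * (\prod_(u in S) P (phi u)) * (\prod_(u in ~: S) (1 - P (phi u)))
      * (discovered e phi S v)%:R).

(* Main.v *)
(* Part (2) is a union bound: a cycle is colorful and kept with probability at
   most [\prod_i p_i <= 1 / Lam].

   For part (1), list the cycles through [v] as words [v, u_2, ..., u_h].  Sorting
   prefixes by the scale of their number of extensions, one level after the
   other, loses a factor [2 (log n + 1)] per level and yields a tree of cycles in
   which a vertex at depth [i] has at least [2 ^ k_i] children, the product of
   these numbers being at least [Lam].  Take [p_i = 2 ^ - k_i], after capping the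
   [k_i] at [log Lam + 1].  Exploring the tree from the root and revealing at
   each level only which candidates are kept with color [i], every level succeeds
   with probability at least [1 - (1 - p_i / h) ^ (1 / p_i) >= (1 - 1 / e) / h]:
   learning that a vertex is not kept with color [i] only makes the other
   outcomes likelier for it.  The first level is [v] itself and costs [1 / h]. *)

Require Import Defs.
From HB Require Import structures.
From mathcomp Require Import all_boot all_order all_algebra.
From mathcomp Require Import reals sequences exp.
From mathcomp Require Import zify ring lra.
Import Order.TTheory GRing.Theory Num.Theory.
Local Open Scope ring_scope.
Set Implicit Arguments. Unset Strict Implicit. Unset Printing Implicit Defensive.

(** * Trees of words with prescribed branching *)

Section RichTrees.
Context {V : finType}.
Implicit Types (A : pred (seq V)) (ks ds : seq nat) (m k : nat).

Fixpoint words m : seq (seq V) :=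
  if m is m'.+1 then [seq rcons p u | p <- words m', u <- enum V] else [:: [::]].

Lemma mem_words (s : seq V) : s \in words (size s).
Proof.
elim/last_ind: s => [//|s u IHs]; rewrite size_rcons /=.
by apply/allpairsP; exists (s, u); split=> //; rewrite mem_enum.
Qed.

Lemma count_words_rcons A m :
  count A (words m.+1) = (\sum_(p <- words m) #|[pred u | A (rcons p u)]|)%N.
Proof.
rewrite /= count_flatten -map_comp sumnE big_map; apply: eq_bigr => p _ /=.
by rewrite count_map cardE [in RHS]/enum_mem size_filter -enumT; apply: eq_count.
Qed.

(* The words of [A] contain a tree all of whose vertices at depth [i] have at
   least [ds_i] children. *)
Fixpoint rich ds A : bool :=
  if ds is d :: ds' then
    (d <= #|[pred u | rich ds' (fun s => A (u :: s))]|)%N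
  else A [::].

Lemma eq_rich ds A B : A =1 B -> rich ds A = rich ds B.
Proof.
elim: ds A B => [|d ds IHds] A B eqAB /=; first exact: eqAB.
congr leq; apply: eq_card => u; rewrite !inE.
by apply: IHds => s; apply: eqAB.
Qed.

(** [rich] unfolds from the root; peeling off the leaves instead suits the count below. *)
Lemma rich_rcons ds d A :
  rich (rcons ds d) A = rich ds (fun p => d <= #|[pred u | A (rcons p u)]|)%N.
Proof.
elim: ds A => [//|d' ds IHds] A /=.
by congr leq; apply: eq_card => u; rewrite !inE IHds.
Qed.

Lemma rich_leq (r : seq nat) (f g : nat -> nat) A :
  (forall k, g k <= f k)%N -> rich (map f r) A -> rich (map g r) A.
Proof.
move=> le_gf; elim: r A => [//|k r IHr] A /= leA.
apply: leq_trans (le_gf k) (leq_trans leA _).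
by apply: subset_leq_card; apply/subsetP => u; rewrite !inE; apply: IHr.
Qed.

Lemma rich_ex ds A : all (fun d => 0 < d)%N ds -> rich ds A -> exists s, A s.
Proof.
elim: ds A => [|d ds IHds] A /=; first by exists [::].
case/andP=> d_gt0 ds_gt0 leA.
have /card_gt0P[u] := leq_trans d_gt0 leA.
by rewrite inE => /(IHds _ ds_gt0)[s As]; exists (u :: s).
Qed.

(** For [d > 0] the term of index [trunc_log 2 d] alone exceeds [d]. *)
Lemma leq_sum_scales K (d : nat) : (d < 2 ^ K)%N ->
  (d <= \sum_(k < K) 2 ^ k.+1 * (2 ^ k <= d))%N.
Proof.
case: d => [//|d] ltdK.
have /andP[ge_d lt_d] := @trunc_log_bounds 2 d.+1 isT isT.
have ltK : (trunc_log 2 d.+1 < K)%N.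
  by rewrite -(@ltn_exp2l 2) //; apply: leq_ltn_trans ltdK.
by rewrite (bigD1 (Ordinal ltK)) //= ge_d muln1 ltnW // ltn_addr.
Qed.

Lemma pigeonhole_leq K T (f : nat -> nat) : (0 < K)%N ->
  (T <= \sum_(k < K) f k)%N -> exists k, (T <= K * f k)%N.
Proof.
move=> K_gt0 leT.
case: (@arg_maxnP 'I_K (Ordinal K_gt0) xpredT (fun k : 'I_K => f k) isT) => k _ maxk.
exists k; apply: leq_trans leT _.
have := @leq_sum _ (index_enum 'I_K) xpredT (fun i : 'I_K => f i) (fun=> f k).
by rewrite sum_nat_const card_ord; apply=> i _; apply: maxk.
Qed.

(* The branching is regularized level by level, starting from the leaves: the
   prefixes are sorted by the power of two just below their number of
   extensions, and the most popular scale is kept. *)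
Lemma rich_of_count m A K : (#|V| < 2 ^ K)%N -> (0 < count A (words m))%N ->
  exists2 ks, size ks = m &
    rich [seq 2 ^ k | k <- ks]%N A /\
    (count A (words m) <= (2 * K) ^ m * 2 ^ sumn ks)%N.
Proof.
move=> ltVK; elim: m A => [|m IHm] A T_gt0.
  by exists [::] => //=; split; move: T_gt0 => /=; case: (A [::]).
(* With [K = 0] the type [V] would be empty, leaving no word of positive length. *)
have K_gt0 : (0 < K)%N.
  case: (posnP K) => // K0; move: T_gt0; rewrite count_words_rcons big1 // => p _.
  apply/eqP; rewrite -leqn0; apply: leq_trans (max_card _) _.
  by move: ltVK; rewrite K0.
pose deg p := #|[pred u | A (rcons p u)]|.
pose B k p := (2 ^ k <= deg p)%N.
have leT : (count A (words m.+1) <= \sum_(k < K) 2 ^ k.+1 * count (B k) (words m))%N.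
  rewrite count_words_rcons.
  have -> : (\sum_(k < K) 2 ^ k.+1 * count (B k) (words m) =
             \sum_(p <- words m) \sum_(k < K) 2 ^ k.+1 * B k p)%N.
    rewrite exchange_big /=; apply: eq_bigr => k _.
    by rewrite -big_distrr /= -sum1_count [in LHS]big_mkcond.
  apply: leq_sum => p _; apply: leq_sum_scales.
  exact: leq_ltn_trans (max_card _) ltVK.
(* Keeping one scale costs a factor [K]; rounding degrees down to powers of two costs the other
   factor 2. *)
have [k lek] :=
  pigeonhole_leq (f := fun k => (2 ^ k.+1 * count (B k) (words m))%N) K_gt0 leT.
have Bk_gt0 : (0 < count (B k) (words m))%N.
  by rewrite lt0n; apply/eqP => Bk0; move: (leq_trans T_gt0 lek); rewrite Bk0 !muln0.
have [ks sz_ks [rich_ks le_ks]] := IHm _ Bk_gt0.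
exists (rcons ks k); rewrite ?size_rcons ?sz_ks //; split.
  by rewrite map_rcons rich_rcons.
apply: leq_trans lek _; rewrite sumn_rcons expnD !expnS.
rewrite -[X in (_ <= X)%N]/((2 * K * (2 * K) ^ m) * (2 ^ sumn ks * 2 ^ k))%N.
move: le_ks; set c := count _ _; set a := (_ ^ m)%N; set b := (2 ^ sumn _)%N => le_ks.
apply: (@leq_trans (K * (2 * 2 ^ k * (a * b)))%N); last by lia.
by rewrite !leq_mul2l le_ks !orbT.
Qed.

(** Either some entry exceeds [J], and its capped value [J >= L] suffices, or capping changes
    nothing. *)
Lemma sumn_map_minn_ge J ks L : (L <= J)%N -> (L <= sumn ks)%N ->
  (L <= sumn (map (minn J) ks))%N.
Proof.
move=> leLJ leL; case: (leqP J (sumn (map (minn J) ks))) => [|lt_sum].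
  exact: leq_trans.
suff -> : map (minn J) ks = ks by [].
rewrite -[RHS]map_id; apply/eq_in_map => k k_ks; apply/minn_idPr.
rewrite leqNgt; apply/negP => ltJk.
have : (minn J k <= sumn (map (minn J) ks))%N.
  elim: ks k_ks {leL lt_sum} => [//|k' ks IHks]; rewrite in_cons /=.
  by case/predU1P => [->|/IHks le_k]; [apply: leq_addr | apply: leq_trans le_k (leq_addl _ _)].
by rewrite (minn_idPl (ltnW ltJk)) leqNgt lt_sum.
Qed.

End RichTrees.

(** * Unnormalized random labellings and the exploration of a tree *)

Section RandomLabelling.
Context {R : realType} {V I : finType}.
Implicit Types (w : V -> I -> bool -> R) (F : {ffun V -> I} -> {set V} -> bool).
Implicit Types (A : pred (seq V)) (js : seq I).

(* Mass of [F] when vertex [u] independently receives color [i] and kept-status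
   [b] with weight [w u i b]; the weights of a vertex need not sum to [1]. *)
Definition mass w F : R :=
  \sum_(phi : {ffun V -> I}) \sum_(S : {set V})
    (\prod_u w u (phi u) (u \in S)) * (F phi S)%:R.

Definition vtot w u : R := \sum_i (w u i true + w u i false).

Lemma mass_total w : mass w (fun _ _ => true) = \prod_u vtot w u.
Proof.
rewrite /vtot bigA_distr_bigA; apply: eq_bigr => phi _.
rewrite bigA_distr; apply: eq_bigr => S _; rewrite mulr1.
by apply: eq_bigr => u _; case: (u \in S).
Qed.

Lemma eq_mass w F F' : (forall (phi : {ffun V -> I}) (S : {set V}), F phi S = F' phi S) ->
  mass w F = mass w F'.
Proof. by move=> eqF; apply: eq_bigr => phi _; apply: eq_bigr => S _; rewrite eqF. Qed.

(** The implication is asked only on labellings of nonzero weight, so that a restricted [w] can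
    carry what has been revealed. *)
Lemma ler_mass w F F' : (forall u i b, 0 <= w u i b) ->
    (forall (phi : {ffun V -> I}) (S : {set V}),
      \prod_u w u (phi u) (u \in S) != 0 -> F phi S -> F' phi S) ->
  mass w F <= mass w F'.
Proof.
move=> w_ge0 leF; apply: ler_sum => phi _; apply: ler_sum => S _.
have [->|nz] := eqVneq (\prod_u w u (phi u) (u \in S)) 0; first by rewrite !mul0r.
apply: ler_wpM2l; first by apply: prodr_ge0 => u _.
by rewrite ler_nat; have := leF phi S nz; case: (F phi S) => //= ->.
Qed.

(** The product over the vertices is linear in the weights of the single vertex [u]. *)
Lemma mass_split w w1 w2 F u :
    (forall i b, w u i b = w1 u i b + w2 u i b) ->
    (forall x i b, x != u -> w1 x i b = w x i b) ->
    (forall x i b, x != u -> w2 x i b = w x i b) ->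
  mass w F = mass w1 F + mass w2 F.
Proof.
move=> wu w1x w2x; rewrite -big_split; apply: eq_bigr => phi _.
rewrite -big_split; apply: eq_bigr => S _ /=; rewrite -mulrDl; congr (_ * _).
rewrite (bigD1 u) //= wu mulrDl; congr (_ + _); rewrite [RHS](bigD1 u) //=;
  by congr (_ * _); apply: eq_bigr => x xu; rewrite ?w1x ?w2x.
Qed.

Fixpoint found js A (phi : {ffun V -> I}) (S : {set V}) : bool :=
  if js is j :: js' then
    [exists u, [&& phi u == j, u \in S & found js' (fun s => A (u :: s)) phi S]]
  else A [::].

Lemma foundP js A phi S : found js A phi S ->
  exists s, [/\ A s, map phi s = js & {subset s <= S}].
Proof.
elim: js A => [|j js IHjs] A /=; first by exists [::].
case/existsP=> u /and3P[/eqP phiu Su /IHjs[s [As phis sS]]].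
exists (u :: s); split; rewrite //= ?phiu ?phis // => x.
by rewrite in_cons => /predU1P[->|/sS].
Qed.

(** Conditioning [u] on [p] without renormalizing: the weight of the event stays visible as [vtot]
    at [u]. *)
Definition restrict w (u : V) (p : I -> bool -> bool) :=
  fun x i b => if (x != u) || p i b then w x i b else 0.

Lemma restrict_ge0 w u p : (forall u i b, 0 <= w u i b) ->
  forall x i b, 0 <= restrict w u p x i b.
Proof. by move=> w_ge0 x i b; rewrite /restrict; case: ifP. Qed.

Lemma restrict_neq w u p x i b : x != u -> restrict w u p x i b = w x i b.
Proof. by rewrite /restrict => ->. Qed.

Lemma vtot_restrict_neq w u p x : x != u -> vtot (restrict w u p) x = vtot w x.
Proof. by move=> xu; apply: eq_bigr => i _; rewrite !restrict_neq. Qed.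

Lemma vtot_restrict1 w u j :
  vtot (restrict w u (fun i b => (i == j) && b)) u = w u j true.
Proof.
rewrite /vtot (bigD1 j) //= big1 => [|i ij].
  by rewrite /restrict !eqxx andbF /= !addr0.
by rewrite /restrict eqxx (negPf ij) /= addr0.
Qed.

Lemma vtot_restrictC w u p :
  vtot (restrict w u p) u + vtot (restrict w u (fun i b => ~~ p i b)) u = vtot w u.
Proof.
rewrite /vtot -big_split; apply: eq_bigr => i _; rewrite /restrict eqxx /=.
by case: (p i true); case: (p i false) => /=; ring.
Qed.

Lemma vtot_ge0 w u : (forall u i b, 0 <= w u i b) -> 0 <= vtot w u.
Proof. by move=> w_ge0; apply: sumr_ge0 => i _; apply: addr_ge0. Qed.

(* The candidates for the first letter are examined one at a time.  When [u] is
   kept with color [j], the search continues below [u]; otherwise the weights of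
   [u] are restricted to the other outcomes, which only makes the other colors
   more likely at [u]. *)
Lemma mass_found_ge js (d : I -> nat) (q : I -> R) A (X : {set V}) w :
    uniq js -> (forall j, (0 < d j)%N) -> (forall j, 0 <= q j <= 1) ->
    (forall u i b, 0 <= w u i b) ->
    (forall u j, u \notin X -> j \in js -> q j * vtot w u <= w u j true) ->
    (forall s, A s -> uniq s && all [predC X] s) ->
    rich (map d js) A ->
  (\prod_u vtot w u) * \prod_(j <- js) (1 - (1 - q j) ^+ d j)
    <= mass w (found js A).
Proof.
move=> + d_gt0 q01; elim: js A X w => [|j js IHjs] A X w.
  move=> _ _ _ _ /= A0; rewrite big_nil mulr1 -mass_total.
  by rewrite (@eq_mass w (fun _ _ => A [::]) (fun _ _ => true)).
case/andP=> jjs ujs w_ge0 le_q AX /= leA.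
pose A' u := fun s => A (u :: s).
pose r : R := \prod_(j <- js) (1 - (1 - q j) ^+ d j).
have q'01 i n : 0 <= (1 - q i) ^+ n <= 1.
  have /andP[q0 q1] := q01 i.
  by rewrite exprn_ge0 ?exprn_ile1 ?subr_ge0 // lerBlDr lerDl.
have r_ge0 : 0 <= r.
  by apply: prodr_ge0 => i _; rewrite subr_ge0; case/andP: (q'01 i (d i)).
have /andP[q0 q1] := q01 j.
pose cs := enum [pred u | rich (map d js) (A' u)].
have rich_cs u : u \in cs -> rich (map d js) (A' u) by rewrite mem_enum inE.
have leq_j u : u \in cs -> q j * vtot w u <= w u j true.
  move=> /rich_cs/rich_ex[]; first by apply/allP => _ /mapP[i _ ->].
  by move=> s /AX/and3P[_ uX _]; apply: le_q uX _; rewrite in_cons eqxx.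
have leq_js u i : u \notin X -> i \in js -> q i * vtot w u <= w u i true.
  by move=> uX ijs; apply: le_q; rewrite // in_cons ijs orbT.
have le_d : (d j <= size cs)%N by rewrite -cardE.
(* The claim is generalized over the unexamined candidates [cs'] and the current weights [w']. [X]
   stays fixed, because a rejected vertex remains usable with later colors. *)
suff main cs' w' : uniq cs' -> {subset cs' <= cs} ->
    (forall u i b, 0 <= w' u i b) ->
    (forall u, u \in cs' -> q j * vtot w' u <= w' u j true) ->
    (forall u i, u \notin X -> i \in js -> q i * vtot w' u <= w' u i true) ->
    (\prod_u vtot w' u) * ((1 - (1 - q j) ^+ size cs') * r)
      <= mass w' (found (j :: js) A).
  rewrite big_cons -/r; apply: le_trans (main cs w _ _ w_ge0 leq_j leq_js) => //.
    apply: ler_wpM2l; first by apply: prodr_ge0 => u _; apply: vtot_ge0.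
    apply: ler_wpM2r => //; rewrite lerD2l lerN2.
    by apply: ler_wiXn2l; rewrite ?subr_ge0 // lerBlDr lerDl.
  exact: enum_uniq.
elim: cs' w' {w w_ge0 le_q leq_j leq_js} => [|u cs' IHcs] w.
  rewrite expr0 subrr mul0r mulr0 => *; apply: sumr_ge0 => phi _.
  by apply: sumr_ge0 => S _; rewrite mulr_ge0 ?prodr_ge0.
case/andP=> ucs' uniq_cs' sub_cs w_ge0 leq_j leq_js.
have u_cs : u \in cs by apply: sub_cs; rewrite in_cons eqxx.
pose yes i b := (i == j) && b.
pose w1 := restrict w u yes; pose w2 := restrict w u (fun i b => ~~ yes i b).
have w1_ge0 := restrict_ge0 u yes w_ge0.
have w2_ge0 := restrict_ge0 u (fun i b => ~~ yes i b) w_ge0.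
have -> : mass w (found (j :: js) A) =
          mass w1 (found (j :: js) A) + mass w2 (found (j :: js) A).
  apply: (@mass_split _ _ _ _ u) => [i b|x i b xu|x i b xu]; [|exact: restrict_neq..].
  by rewrite /w1 /w2 /restrict eqxx /=; case: (yes i b); rewrite ?addr0 ?add0r.
pose W : R := \prod_(x | x != u) vtot w x.
have W_ge0 : 0 <= W by apply: prodr_ge0 => x _; apply: vtot_ge0.
have prodW w' : (forall x, x != u -> vtot w' x = vtot w x) ->
    \prod_x vtot w' x = vtot w' u * W.
  by move=> w'x; rewrite (bigD1 u) //=; congr (_ * _); apply: eq_bigr.
have le1 : w u j true * W * r <= mass w1 (found (j :: js) A).
  apply: (@le_trans _ _ (mass w1 (found js (A' u)))); last first.
    apply: ler_mass => // phi S nz fnd /=; apply/existsP; exists u.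
    suff /andP[-> ->] : (phi u == j) && (u \in S) by [].
    apply: contraNT nz => nyes; rewrite (bigD1 u) //= /w1 /restrict eqxx /=.
    by rewrite /yes (negPf nyes) mul0r.
  rewrite -(vtot_restrict1 w u j) -prodW; last first.
    by move=> x xu; apply: vtot_restrict_neq.
  (* The outcome of [u] is settled, so [u] joins [X]; words of [A] have distinct letters and avoid
     it further down. *)
  apply: (IHjs (A' u) (u |: X)) => //; last exact: rich_cs.
    move=> x i; rewrite !inE negb_or => /andP[xu xX] ijs.
    by rewrite vtot_restrict_neq // /w1 /w2 restrict_neq //; apply: leq_js.
  move=> s /AX /= /andP[/andP[us ->] /andP[uX /allP sX]].
  apply/allP => x xs; rewrite /= !inE negb_or; move: (sX x xs) => /= ->; rewrite andbT.
  by apply: contraNneq us => <-.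
have le2 : vtot w2 u * W * ((1 - (1 - q j) ^+ size cs') * r)
             <= mass w2 (found (j :: js) A).
  rewrite -prodW; last by move=> x xu; apply: vtot_restrict_neq.
  apply: IHcs => // [x xcs|x xcs|x i xX ijs].
  - by apply: sub_cs; rewrite in_cons xcs orbT.
  - have xu : x != u by apply: contraNneq ucs' => <-.
    by rewrite vtot_restrict_neq // /w1 /w2 restrict_neq // leq_j // in_cons xcs orbT.
  - have [xu|xu] := eqVneq x u; last first.
      by rewrite vtot_restrict_neq // /w1 /w2 restrict_neq // leq_js.
    rewrite {}xu {x} in xX *.
    have ij : i != j by apply: contraNneq jjs => <-.
    (* For [i != j] the weight of color [i] at [u] is unchanged, while [vtot] has not increased. *)
    apply: (@le_trans _ _ (q i * vtot w u)).
      apply: ler_wpM2l; first by case/andP: (q01 i).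
      by rewrite -(vtot_restrictC w u yes) lerDr vtot_ge0.
    by rewrite /w2 /restrict eqxx /yes (negPf ij) /=; apply: leq_js.
rewrite (prodW w) // -(vtot_restrictC w u yes) vtot_restrict1.
apply: le_trans (lerD le1 le2); rewrite exprS -/w2.
have := leq_j u (mem_head _ _).
rewrite -(vtot_restrictC w u yes) vtot_restrict1 -/w2.
have /andP[y0 y1] := q'01 j (size cs').
move: ((1 - q j) ^+ size cs') (w u j true) (vtot w2 u) y0 y1 => y a b y0 y1 leq_ab.
(* The difference of the two sides is the slack [a - q j * (a + b)] of the hypothesis on [u], times
   nonnegative factors. *)
rewrite -subr_ge0.
have -> : a * W * r + b * W * ((1 - y) * r) - (a + b) * W * ((1 - (1 - q j) * y) * r)
   = (W * r) * (y * (a - q j * (a + b))) by ring.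
by apply: mulr_ge0; [exact: mulr_ge0 | apply: mulr_ge0 => //; rewrite subr_ge0].
Qed.

End RandomLabelling.

(** * The discovery experiment and the union bound *)

Section Discovery.
Context {R : realType} {V : finType} {h : nat}.
Implicit Types (P : 'I_h -> R) (e : rel V) (c : {ffun 'I_h -> V}) (v : V).

Definition discovery_weight P (_ : V) (i : 'I_h) (b : bool) : R :=
  h%:R^-1 * (if b then P i else 1 - P i).

Lemma vP_mass P e v :
  vP e P v = mass (discovery_weight P) (fun phi S => discovered e phi S v).
Proof.
apply: eq_bigr => phi _; apply: eq_bigr => S _; congr (_ * _).
rewrite big_split /= prodr_const -exprVn -mulrA; congr (_ * _).
rewrite [RHS](bigID (mem S)) /=; congr (_ * _); first by apply: eq_bigr => u ->.
by apply: eq_big => [u|u]; rewrite !inE // => /negPf ->.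
Qed.

Lemma discovery_weight_ge0 P u i b :
  (forall i, 0 <= P i <= 1) -> 0 <= discovery_weight P u i b.
Proof.
by move=> /(_ i)/andP[P0 P1]; rewrite mulr_ge0 ?invr_ge0 //; case: b; rewrite ?subr_ge0.
Qed.

(** A coloring injective on the [h] vertices shows each color exactly once there, so all are kept
    with probability [\prod_i P i]; the colorings weigh at most 1 in total. *)
Lemma mass_subset_inj P c : injective c -> (forall i, 0 <= P i <= 1) ->
  mass (discovery_weight P)
    (fun phi S => (c @: 'I_h \subset S) && injectiveb (phi \o c)) <= \prod_i P i.
Proof.
move=> c_inj P01; pose A : {set V} := c @: 'I_h.
have prodP0 : 0 <= \prod_i P i by apply: prodr_ge0 => i _; case/andP: (P01 i).
have inner (phi : {ffun V -> 'I_h}) :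
    \sum_(S : {set V}) (\prod_u discovery_weight P u (phi u) (u \in S)) *
       ((A \subset S) && injectiveb (phi \o c))%:R <= h%:R^-1 ^+ #|V| * \prod_i P i.
  case: (boolP (injectiveb _)) => [/injectiveP phic_inj|_]; last first.
    rewrite big1 => [|S _]; last by rewrite andbF mulr0.
    by rewrite mulr_ge0 // exprn_ge0 // invr_ge0.
  pose f u : R := h%:R^-1 * P (phi u).
  (* The weight of not being kept is set to 0 on [A], so that expanding the product leaves only the
     sets [S] containing [A]. *)
  pose g u : R := if u \in A then 0 else h%:R^-1 * (1 - P (phi u)).
  have -> : \sum_(S : {set V}) (\prod_u discovery_weight P u (phi u) (u \in S)) *
       ((A \subset S) && true)%:R = \prod_u (f u + g u).
    rewrite bigA_distr; apply: eq_bigr => S _; rewrite andbT.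
    have [/subsetP AS|/subsetPn[u uA uS]] := boolP (A \subset S); last first.
      by rewrite mulr0 [RHS](bigD1 u) //= (negPf uS) /g uA mul0r.
    rewrite mulr1; apply: eq_bigr => u _; rewrite /discovery_weight /f /g.
    case: ifP => // /negP uS; case: ifP => // /AS //.
  rewrite -[X in h%:R^-1 ^+ X]/(#|xpredT : pred V|) -prodr_const.
  have -> : \prod_i P i = \prod_(u in A) P (phi u).
    rewrite big_imset /=; last by move=> x y _ _; apply: c_inj.
    by rewrite (reindex_inj phic_inj); apply: eq_bigl => i; rewrite inE.
  rewrite [X in _ * X]big_mkcond -big_split /= ler_prod // => u _.
  have /andP[P0 P1] := P01 (phi u); rewrite /f /g.
  case: ifP => _; last by rewrite -mulrDr addrC subrK mulr1 lexx invr_ge0 ler0n.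
  by rewrite addr0 lexx mulr_ge0 // invr_ge0.
apply: le_trans (ler_sum _ (fun phi _ => inner phi)) _.
rewrite sumr_const card_ffun card_ord -[leLHS]mulr_natl natrX mulrA -exprMn.
rewrite ler_piMl // exprn_ile1 ?mulr_ge0 ?invr_ge0 //.
(* For [h = 0] the quotient [h / h] is 0 rather than 1. *)
by have [->|h0] := eqVneq (h%:R : R) 0; rewrite ?mul0r ?ler01 // divff.
Qed.

Lemma cover_cycle_edges c : cover (cycle_edges c) = c @: 'I_h.
Proof.
apply/setP => x; apply/bigcupP/imsetP.
  case=> E /imsetP[i _ ->]; rewrite !inE => /orP[/eqP->|/eqP->]; first by exists i.
  by exists (ordS i).
case=> i _ ->; exists [set c i; c (ordS i)]; last by rewrite !inE eqxx.
exact: imset_f.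
Qed.

(** Since [tG] counts edge sets, the union bound runs over edge sets [C], with [cover C] recovering
    the vertices; indexing by [c] would count a cycle once per parametrization. *)
Lemma vP_le_cycles P e v : (forall i, 0 <= P i <= 1) ->
  vP e P v <= (tG e h v)%:R * \prod_i P i.
Proof.
move=> P01; rewrite vP_mass /tG.
set Cs := [set C | _].
pose D (C : {set {set V}}) (phi : {ffun V -> 'I_h}) (S : {set V}) :=
  (cover C \subset S) && dinjectiveb phi (cover C).
apply: (@le_trans _ _ (\sum_(C in Cs) mass (discovery_weight P) (D C))).
  rewrite exchange_big; apply: ler_sum => phi _.
  rewrite exchange_big; apply: ler_sum => S _ /=; rewrite -mulr_sumr.
  apply: ler_wpM2l; first by apply: prodr_ge0 => u _; apply: discovery_weight_ge0.
  have [/existsP[c /and4P[c_cyc /codomP[i vci] /forallP cS /injectiveP phic]]|_] :=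
    boolP (discovered _ _ _ _); last by apply: sumr_ge0.
  rewrite (bigD1 (cycle_edges c)) /=; last first.
    rewrite inE; apply/andP; split; first by apply/existsP; exists c; rewrite c_cyc /=.
    apply/existsP; exists [set c i; c (ordS i)].
    by apply/andP; split; [apply: imset_f | rewrite !inE vci eqxx].
  rewrite /D cover_cycle_edges.
  have -> : c @: 'I_h \subset S by apply/subsetP => _ /imsetP[k _ ->].
  have -> : dinjectiveb phi (c @: 'I_h).
    by apply/dinjectiveP => _ _ /imsetP[k _ ->] /imsetP[l _ ->] /phic ->.
  by rewrite lerDl sumr_ge0.
rewrite mulr_natl -sumr_const; apply: ler_sum => C.
rewrite inE => /andP[/existsP[c /andP[/andP[/injectiveP c_inj _] /eqP ->]] _].
apply: le_trans (mass_subset_inj c_inj P01).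
apply: ler_mass => [u i b|phi S _]; first exact: discovery_weight_ge0.
rewrite /D cover_cycle_edges => /andP[-> /dinjectiveP phi_inj] /=.
apply/injectiveP => i k /= eq_ik; apply: c_inj; apply: phi_inj eq_ik; exact: imset_f.
Qed.

Lemma inProduct_bounds (Lam : R) P : inProduct Lam P -> forall i, 0 <= P i <= 1.
Proof.
case=> + _ => /[swap] i /(_ i)[j [_ ->]].
by rewrite invr_ge0 exprn_ge0 //= invf_le1 ?exprn_gt0 // exprn_ege1 // ler1n.
Qed.

End Discovery.

(** * Reading cycles as words from [v] *)

Section CyclesThroughVertex.
Context {V : finType}.
Variables (e : rel V) (m : nat) (v : V).

Definition cycle_fun (s : seq V) : {ffun 'I_m.+1 -> V} := [ffun i : 'I_m.+1 => nth v s i].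

Definition cycle_word (s : seq V) := (size s == m) && is_hcycle_seq e (cycle_fun (v :: s)).

Definition rotate (c : {ffun 'I_m.+1 -> V}) (i : 'I_m.+1) : {ffun 'I_m.+1 -> V} :=
  [ffun k => c (i + k)].

Lemma addr_ordS (i k : 'I_m.+1) : i + ordS k = ordS (i + k).
Proof.
by apply: val_inj; rewrite /= modnDmr addnS -[in RHS]addn1 modnDml addn1.
Qed.

Lemma rotate_hcycle c i : is_hcycle_seq e c -> is_hcycle_seq e (rotate c i).
Proof.
case/andP=> /injectiveP c_inj /forallP ce; apply/andP; split.
  by apply/injectiveP => k l; rewrite !ffunE => /c_inj/addrI.
by apply/forallP => k; rewrite !ffunE addr_ordS.
Qed.

Lemma rotate_edges c i : cycle_edges (rotate c i) = cycle_edges c.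
Proof.
apply/setP => E; apply/imsetP/imsetP => -[k _ ->].
  by exists (i + k) => //; rewrite !ffunE addr_ordS.
by exists (k - i) => //; rewrite !ffunE addr_ordS addrC subrK.
Qed.

(** Rotating a cycle to start at [v] preserves its edge set, so taking edges maps the words onto the
    cycles through [v]. *)
Lemma leq_tG_count : (tG e m.+1 v <= count cycle_word (words m))%N.
Proof.
rewrite /tG cardE -size_filter -(size_map (fun s => cycle_edges (cycle_fun (v :: s)))).
apply: uniq_leq_size; first exact: enum_uniq.
move=> C; rewrite mem_enum inE => /andP[/existsP[c /andP[c_cyc /eqP ->]]].
case/existsP=> E /andP[/imsetP[i0 _ ->] vE].
have [i civ] : exists i, c i = v.
  by move: vE; rewrite !inE => /orP[/eqP->|/eqP->]; [exists i0 | exists (ordS i0)].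
pose s := behead [seq rotate c i k | k <- enum 'I_m.+1].
have sz_s : size s = m by rewrite size_behead size_map size_enum_ord.
have vs : v :: s = [seq rotate c i k | k <- enum 'I_m.+1].
  by rewrite /s enum_ordSl /= ffunE addr0 civ.
have cs : cycle_fun (v :: s) = rotate c i.
  apply/ffunP => k; rewrite ffunE vs (nth_map k) ?size_enum_ord //.
  by rewrite nth_ord_enum.
apply/mapP; exists s; last by rewrite cs rotate_edges.
by rewrite mem_filter /cycle_word sz_s eqxx cs rotate_hcycle // -sz_s mem_words.
Qed.

End CyclesThroughVertex.

(** * Logarithms and the success probability of one level *)

Section Estimates.
Context {R : realType}.

Lemma log2X (k : nat) : log2 (2 ^+ k : R) = k%:R.
Proof.
by rewrite /log2 lnXn ?ltr0n // -[_ *+ k]mulr_natl mulfK // gt_eqF // ln_gt0 // ltr1n.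
Qed.

Lemma ler_log2 (x y : R) : 0 < x -> x <= y -> log2 x <= log2 y.
Proof.
move=> x0 lexy; rewrite ler_pM2r ?invr_gt0 ?ln_gt0 ?ltr1n //.
by rewrite ler_ln // posrE // (lt_le_trans x0).
Qed.

Lemma log2_lt (x : R) k : log2 x < k%:R -> x <= 2 ^+ k.
Proof.
move=> lt_xk; rewrite leNgt; apply/negP => lt_kx.
have := ler_log2 (exprn_gt0 k (ltr0Sn R 1)) (ltW lt_kx).
by rewrite log2X leNgt lt_xk.
Qed.

(* With [y = (1 - p / h) ^ (1 / p)] one has [y ^ h <= 1 / e], and Bernoulli's
   inequality gives [1 - y ^ h <= h (1 - y)]. *)
Lemma hit_probability_ge (h k : nat) : (0 < h)%N ->
  (1 - (expR 1)^-1) / h%:R <= 1 - (1 - h%:R^-1 * 2 ^- k) ^+ (2 ^ k) :> R.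
Proof.
move=> h_gt0; have h0 : 0 < h%:R :> R by rewrite ltr0n.
set x := h%:R^-1 * _; set y := _ ^+ (2 ^ k).
have x0 : 0 <= x by rewrite mulr_ge0 ?invr_ge0 // exprn_ge0.
have x1 : x <= 1.
  rewrite mulr_ile1 ?invr_ge0 ?exprn_ge0 // ?invf_le1 ?exprn_gt0 ?ler1n //.
  by rewrite exprn_ege1 // ler1n.
have y01 : 0 <= y <= 1.
  by rewrite exprn_ge0 ?exprn_ile1 ?subr_ge0 // lerBlDr lerDl.
have /andP[y0 y1] := y01.
have yh : y ^+ h <= (expR 1)^-1.
  rewrite -expRN /y -exprM.
  (* As [x = 1 / (h * 2 ^ k)], raising [1 - x <= expR (- x)] to the power [2 ^ k * h] gives
     [expR (- 1)] on the right. *)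
  have -> : -1 = (2 ^ k * h)%:R * (- x).
    rewrite natrM natrX /x; field; rewrite gt_eqF ?exprn_gt0 //=.
    by rewrite gt_eqF.
  rewrite expRM_natl; apply: lerXn2r; rewrite ?nnegrE ?subr_ge0 ?expR_ge0 //.
  exact: expR_ge1Dx.
rewrite ler_pdivrMr //; apply: (@le_trans _ _ (1 - y ^+ h)).
  by rewrite lerD2l lerN2.
rewrite -opprB subrX1 -mulNr opprB ler_wpM2l ?subr_ge0 //.
have := @ler_sum _ _ (index_enum 'I_h) xpredT (fun i => y ^+ i) (fun=> 1).
by rewrite sumr_const card_ord; apply=> i _; apply: exprn_ile1.
Qed.

End Estimates.

(** * From a rich tree of cycles to a discovery probability *)

Section RichCycles.
Context {R : realType} {V : finType}.
Variables (e : rel V) (m : nat) (v : V).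

(** The leading 0 is the exponent for the color of the root: vertices of that color are always
    kept. *)
Definition scale_vector (ks : seq nat) : 'I_m.+1 -> R :=
  fun i => 2%:R ^- nth 0%N (0%N :: ks) i.

Lemma prod_scale_vector ks : size ks = m ->
  \prod_i scale_vector ks i = 2%:R ^- sumn ks.
Proof.
move=> sz; rewrite prodfV prodrXr; congr (_ ^- _).
by rewrite -[sumn ks]/(sumn (0%N :: ks)) sumnE (big_nth 0%N) /= sz big_mkord.
Qed.

Definition rooted_cycle_word (s : seq V) :=
  if s is u :: s' then (u == v) && cycle_word e m v s' else false.

Lemma rooted_cycle_wordP s : rooted_cycle_word s ->
  [/\ size s = m.+1, head v s = v & is_hcycle_seq e (cycle_fun m v s)].
Proof.
by case: s => [//|u s] /= /andP[/eqP -> /andP[/eqP <- ->]].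
Qed.

(** This is the exploration bound for [q i = P i / h], started from the original weights, where
    every [vtot] is 1. *)
Lemma rich_cycles_vP_ge ks : size ks = m ->
    rich [seq 2 ^ k | k <- ks]%N (cycle_word e m v) ->
  (1 - (expR 1)^-1) ^+ m * (m.+1%:R ^+ m.+1)^-1 <= vP e (scale_vector ks) v :> R.
Proof.
move=> sz_ks rich_ks; set P := scale_vector ks.
pose k (i : 'I_m.+1) := nth 0%N (0%N :: ks) i.
have P01 i : 0 <= P i <= 1.
  by rewrite invr_ge0 exprn_ge0 //= invf_le1 ?exprn_gt0 // exprn_ege1 // ler1n.
have vtot1 u : vtot (discovery_weight (V:=V) P) u = 1.
  rewrite /vtot (eq_bigr (fun=> m.+1%:R^-1)) => [|i _].
    by rewrite sumr_const card_ord -[_ *+ _]mulr_natl divff // pnatr_eq0.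
  by rewrite -mulrDr addrC subrK mulr1.
rewrite vP_mass.
apply: (@le_trans _ _ (mass (discovery_weight P)
          (found (enum 'I_m.+1) rooted_cycle_word))); last first.
  apply: ler_mass => [u i b|phi S _]; first exact: discovery_weight_ge0.
  case/foundP=> s [/rooted_cycle_wordP[sz_s hd_s cyc] phis sS].
  apply/existsP; exists (cycle_fun m v s); rewrite cyc /=.
  (* The search asks for the colors in increasing order, so the cycle found is colored by its own
     indices. *)
  have phic i : phi (cycle_fun m v s i) = i.
    by rewrite ffunE -(nth_map v i phi) ?sz_s // phis nth_ord_enum.
  apply/and3P; split.
  - by apply/codomP; exists ord0; rewrite ffunE nth0.
  - by apply/forallP => i; rewrite ffunE sS // mem_nth // sz_s.
  - by apply/injectiveP => i j; rewrite !phic.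
apply: (@le_trans _ _ ((\prod_u vtot (discovery_weight P) u) *
   \prod_(i <- enum 'I_m.+1) (1 - (1 - m.+1%:R^-1 * P i) ^+ (2 ^ k i)))); last first.
  apply: (mass_found_ge (X := set0)) => //.
  - exact: enum_uniq.
  - by move=> i; rewrite expn_gt0.
  - move=> i; have /andP[P0 P1] := P01 i.
    apply/andP; split; first by apply: mulr_ge0; rewrite // invr_ge0.
    by apply: mulr_ile1 => //; rewrite ?invr_ge0 // invf_le1 ?ltr0n // ler1n.
  - by move=> u i b; apply: discovery_weight_ge0.
  - by move=> u i _ _; rewrite vtot1 mulr1.
  - move=> s /rooted_cycle_wordP[sz_s _ /andP[/injectiveP c_inj _]].
    apply/andP; split; last by apply/allP => x _; rewrite /= inE.
    apply/(uniqP v) => i j; rewrite !inE sz_s => lti ltj eq_ij.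
    have := c_inj (Ordinal lti) (Ordinal ltj).
    by rewrite !ffunE => /(_ eq_ij)/(congr1 val).
  - have -> : [seq (2 ^ k i)%N | i <- enum 'I_m.+1] = [seq (2 ^ k)%N | k <- 0%N :: ks].
      apply: (@eq_from_nth _ 0%N) => [|i].
        by rewrite size_map size_enum_ord size_map /= sz_ks.
      rewrite size_map size_enum_ord => lti.
      by rewrite (nth_map ord0) ?size_enum_ord // (nth_map 0%N) /= ?sz_ks // /k nth_enum_ord.
    rewrite /= expn0; apply/card_gt0P; exists v; rewrite inE.
    by rewrite (@eq_rich _ _ _ (cycle_word e m v)) // => s; rewrite /= eqxx.
rewrite big1 ?mul1r; last by move=> u _; apply: vtot1.
(* The root level has [P = 1] and one candidate, and contributes [1 - (1 - 1 / h) = 1 / h]. *)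
rewrite big_enum /= big_ord_recl /= /P /scale_vector /= expr0 invr1 mulr1 expn0 expr1.
rewrite subKr.
rewrite exprS invfM mulrCA ler_pM2l ?invr_gt0 ?ltr0n // -exprVn -exprMn.
rewrite -[X in _ ^+ X]card_ord -prodr_const ler_prod // => i _.
rewrite hit_probability_ge // andbT mulr_ge0 ?invr_ge0 // subr_ge0.
by rewrite invf_le1 ?expR_gt0 // (le_trans _ (expR_ge1Dx _)) // lerDl.
Qed.

End RichCycles.

(** * Choosing the vector for a vertex on many cycles *)

Section HeavyVertices.
Context {R : realType} {V : finType}.
Variables (e : rel V) (m : nat) (v : V).

(** [B ^ m] pays for the loss [(2 * K) ^ m] of the regularization, leaving [L] for the product of
    the branching numbers. *)
Lemma rich_scales_of_tG (L B : R) K : (#|V| < 2 ^ K)%N -> 0 < L ->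
    0 < B -> 2 * K%:R <= B -> L * B ^+ m <= (tG e m.+1 v)%:R ->
  exists2 ks, size ks = m &
    rich [seq 2 ^ k | k <- ks]%N (cycle_word e m v) /\ L <= 2 ^+ sumn ks.
Proof.
move=> ltVK L_gt0 B_gt0 leKB le_t.
pose T := count (cycle_word e m v) (words m).
have le_T : L * B ^+ m <= T%:R by rewrite (le_trans le_t) // ler_nat leq_tG_count.
have T_gt0 : (0 < T)%N.
  by rewrite -(ltr0n R) (lt_le_trans _ le_T) // mulr_gt0 ?exprn_gt0.
have [ks sz_ks [rich_ks le_ks]] := rich_of_count ltVK T_gt0.
exists ks => //; split=> //.
rewrite -(ler_pM2r (exprn_gt0 m B_gt0)); apply: le_trans le_T _.
move: le_ks; rewrite -(ler_nat R) natrM !natrX => /le_trans; apply.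
rewrite mulrC ler_wpM2l ?exprn_ge0 //.
by apply: lerXn2r; rewrite ?nnegrE ?ler0n ?(ltW B_gt0) // natrM.
Qed.

Lemma exists_product_vector (L : R) ks : 1 < L -> size ks = m ->
    rich [seq 2 ^ k | k <- ks]%N (cycle_word e m v) -> L <= 2 ^+ sumn ks ->
  exists P : 'I_m.+1 -> R, inProduct L P /\
    (1 - (expR 1)^-1) ^+ m * (m.+1%:R ^+ m.+1)^-1 <= vP e P v.
Proof.
move=> L_gt1 sz_ks rich_ks le_L.
have L_gt0 : 0 < L by apply: lt_trans L_gt1.
have logL_ge0 : 0 <= log2 L + 1.
  by rewrite addr_ge0 // divr_ge0 ?ln_ge0 ?ler1n // ltW.
have /andP[leJ ltJ] := truncn_itv logL_ge0.
set J := Num.truncn _ in leJ ltJ.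
pose ks' := map (minn J) ks.
have le_L' : L <= 2 ^+ sumn ks'.
  (* From [J + 1 > log2 L + 1] follows [L <= 2 ^ J]: the [+ 1] in [inProduct] leaves room for this
     cap. *)
  have : L <= 2 ^+ minn J (sumn ks).
    by case: leqP => // _; apply: log2_lt; move: ltJ; rewrite -natr1 ltrD2r.
  move/le_trans; apply; apply: ler_weXn2l; first by rewrite ler1n.
  by apply: sumn_map_minn_ge; rewrite ?geq_minl ?geq_minr.
have sz_ks' : size ks' = m by rewrite size_map.
exists (scale_vector ks'); split; last first.
  apply: rich_cycles_vP_ge => //; rewrite -map_comp.
  by apply: rich_leq rich_ks => k /=; rewrite leq_exp2l // geq_minr.
split=> [i|]; last by rewrite prod_scale_vector // lef_pV2 ?posrE ?exprn_gt0.
exists (nth 0%N (0%N :: ks') i); split=> //; apply: le_trans leJ; rewrite ler_nat.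
case: i => -[|i] //= lti; rewrite (nth_map 0%N) ?sz_ks //; exact: geq_minl.
Qed.

End HeavyVertices.

(** * Both bounds for large [n] *)

Unset Implicit Arguments.

Theorem theorem7 (R : realType) (h : nat) (Lam : nat -> R) :
  (3 <= h)%N ->
  (forall M : R, exists N : nat, forall n : nat, (N <= n)%N -> M < Lam n) ->
  exists N : nat, forall (V : finType) (e : rel V),
    symmetric e -> irreflexive e -> (N <= #|V|)%N ->
    let n := #|V| in
    let s : R := (h%:R ^+ h)^-1 in
    (forall v : V,
        Lam n * (2%:R * h%:R * log2 (n%:R : R)) ^+ ((h - 1) ^ 2) * (2%:R / s)
          <= (tG e h v)%:R ->
        exists P : 'I_h -> R, inProduct (Lam n) P /\
          (1 - (expR 1)^-1) ^+ (h - 1) * s <= vP e P v) /\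
    (forall v : V, (tG e h v)%:R <= Lam n / log2 (n%:R : R) ->
        forall P : 'I_h -> R, inProduct (Lam n) P ->
          vP e P v <= (log2 (n%:R : R))^-1).
Proof.
move=> h3 /(_ 1)[N0 Lam_gt1].
(* [N0] gives [Lam n > 1], and [n >= 2] gives [log2 n >= 1]. *)
exists (maxn N0 2) => V e _ _; rewrite geq_max => /andP[leN0n n_ge2] n s.
have L_gt1 : 1 < Lam n by apply: Lam_gt1.
have L_gt0 : 0 < Lam n by apply: lt_trans L_gt1.
set L := Lam n in L_gt1 L_gt0 *; set l := log2 _.
have n_gt0 : 0 < n%:R :> R by rewrite ltr0n ltnW.
have l_ge1 : 1 <= l.
  by rewrite -[1]/(1%:R) -(@log2X R 1) ler_log2 // expr1 ler_nat.
split=> v.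
  case: h h3 @s => [//|m] h3 s; rewrite subn1 /= => le_t.
  have hl_ge2 : 2 <= m.+1%:R * l.
    by rewrite -[2]mulr1 ler_pM // ler_nat ltnW.
  set B := 2 * m.+1%:R * l in le_t.
  have B_ge1 : 1 <= B by rewrite /B -mulrA; lra.
  (* [K = trunc_log 2 n + 1] satisfies [n < 2 ^ K] and [K <= l + 1 <= 2 * l <= m.+1 * l]. *)
  have leKB : 2 * (trunc_log 2 n).+1%:R <= B.
    rewrite /B -mulrA ler_pM2l // -natr1.
    have : (trunc_log 2 n)%:R <= l.
      rewrite -(@log2X R) ler_log2 ?exprn_gt0 // -natrX ler_nat.
      by apply: trunc_logP; rewrite // ltnW.
    suff : l + 1 <= m.+1%:R * l by lra.
    apply: (@le_trans _ _ (2 * l)); first by lra.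
    by rewrite ler_wpM2r ?ler_nat ?(le_trans ler01) // ltnW.
  have le_t' : L * B ^+ m <= (tG e m.+1 v)%:R.
    apply: le_trans le_t; rewrite -mulrA ler_pM2l //.
    rewrite -[leLHS]mulr1; apply: ler_pM => //.
    - by rewrite exprn_ge0 // (le_trans ler01).
    - by rewrite ler_weXn2l // -{1}(expn1 m) leq_pexp2l //; case: (m) h3.
    - rewrite /s invrK; apply: (@le_trans _ _ 2); first by rewrite ler1n.
      by rewrite ler_peMr // exprn_ege1 // ler1n.
  have [ks sz_ks [rich_ks le_L]] :=
    rich_scales_of_tG (@trunc_log_ltn 2 n isT) L_gt0 (lt_le_trans ltr01 B_ge1) leKB le_t'.
  exact: exists_product_vector L_gt1 sz_ks rich_ks le_L.
move=> le_t P inP; apply: le_trans (vP_le_cycles e v (inProduct_bounds inP)) _.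
have prodP0 : 0 <= \prod_i P i.
  by apply: prodr_ge0 => i _; case/andP: (inProduct_bounds inP i).
apply: (@le_trans _ _ (L / l * L^-1)).
  by apply: ler_pM => //; case: inP.
by rewrite mulrAC divff ?gt_eqF // mul1r.
Qed.
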